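(* Consider any discrete-time queue with a scheduling rule and an observation epoch $u(\tau)$. Suppose $\tau^{-1}A(\tau)\to\lambda$ as $\tau\to\infty$, where $0\le\lambda<\infty$, and $n^{-1}\sum_{k=1}^nW^o_k\to W^o$ as $n\to\infty$, where $0\le W^o<\infty$. Then $\tau^{-1}\sum_{j=0}^\tau L^o(u(j))\to L^o$ as $\tau\to\infty$, and $$L^o=\lambda W^o.$$ Moreover, let $W=\lim_{n\to\infty}n^{-1}\sum_{k=1}^nW_k$ be the mean waiting time of the actual system. Then (i) for coherent systems $L^o=\lambda W$; (ii) for sub-coherent systems $L^o=\lambda(W-1)$; (iii) for super-coherent systems $L^o=\lambda(W+1)$.
   Context: Time is discrete, $\tau=0,1,2,\dots$. In the actual system customer $k\ge1$ arrives at the integer $A_k$ and departs at the integer $D_k$, where $0\le A_k\le A_{k+1}$, $A_k\to\infty$, and $D_k\ge A_k+1$ (service times are at least one). Let $A(\tau)=\#\{k:A_k\le\tau\}$. The actual waiting time (time in system) is $W_k=D_k-A_k$. Near each integer $\tau$ there are instants $\tau^{--}<\tau^-<\tau<\tau^+$ infinitesimally close to $\tau$ (formally $\tau-2\varepsilon,\ \tau-\varepsilon,\ \tau,\ \tau+\varepsilon$ with a fixed $0<\varepsilon<1/8$). A scheduling rule replaces $A_k,D_k$ by scheduled instants $A'_k,D'_k$ located as follows. EAS: $A'_k\in(A_k,A_k^+)$, $D'_k\in(D_k^-,D_k)$. LAS-IA: $A'_k\in(A_k^-,A_k)$, $D'_k\in(D_k-1,(D_k-1)^+)$. LAS-DA: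 $A'_k\in(A_k^-,A_k)$, $D'_k\in(D_k,D_k^+)$. LA-AF: $A'_k\in(A_k^{--},A_k^-)$, $D'_k\in(D_k^-,D_k)$. LA-DF: $A'_k\in(A_k^-,A_k)$, $D'_k\in(D_k^{--},D_k^-)$. The observation epoch $u(\tau)$ is one of: random observer, $u(\tau)=\tau$; outside observer, $u(\tau)=\tau-0.5$; or the potential pre-arrival, post-arrival, pre-departure, post-departure epochs, which are respectively $\tau,\tau^+,\tau^-,\tau$ for EAS; $\tau^-,\tau,\tau,\tau^+$ for LAS-IA and LAS-DA; $\tau^{--},\tau^-,\tau^-,\tau$ for LA-AF; $\tau^-,\tau,\tau^{--},\tau^-$ for LA-DF. The observed number in system and observed waiting times are $$L^o(u(\tau))=\sum_{k=1}^\infty\mathbf 1\{A'_k<u(\tau)\le D'_k\},\qquad W^o_k=\sum_{\tau=0}^\infty\mathbf 1\{A'_k<u(\tau)\le D'_k\}.$$ The system is coherent if $W^o_k=W_k$ for all $k$; sub-coherent if $W^o_k<W_k$ for some $k$; super-coherent if $W^o_k>W_k$ for some $k$. *)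

(* Defs.v *)
From Stdlib Require Import Reals Ensembles Finite_sets.
From Coquelicot Require Import Coquelicot.
Open Scope R_scope.

(* Customers are numbered from 1: the values at index 0 of the sequences
   [A], [D], [A'], [D'] are never used. *)

Record discrete_time_queue (A D : nat -> nat) : Prop := {
  arrivals_ordered : forall k, (1 <= k)%nat -> (A k <= A (S k))%nat;
  arrivals_diverge : is_lim_seq (fun k => INR (A k)) p_infty;
  service_at_least_one : forall k, (1 <= k)%nat -> (A k + 1 <= D k)%nat
}.

Definition arrived_by (A : nat -> nat) (tau : nat) : Ensemble nat :=
  fun k => (1 <= k)%nat /\ (A k <= tau)%nat.

Definition wait (A D : nat -> nat) (k : nat) : R := INR (D k) - INR (A k).

(* The instants t^{--}, t^-, t^+ around an integer t. *)
Definition minus2 (eps t : R) : R := t - 2 * eps.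
Definition minus1 (eps t : R) : R := t - eps.
Definition plus1 (eps t : R) : R := t + eps.

Inductive scheduling_rule : Set := EAS | LAS_IA | LAS_DA | LA_AF | LA_DF.

Definition arrival_window (eps : R) (s : scheduling_rule) (a x : R) : Prop :=
  match s with
  | EAS => a < x < plus1 eps a
  | LAS_IA => minus1 eps a < x < a
  | LAS_DA => minus1 eps a < x < a
  | LA_AF => minus2 eps a < x < minus1 eps a
  | LA_DF => minus1 eps a < x < a
  end.

Definition departure_window (eps : R) (s : scheduling_rule) (d x : R) : Prop :=
  match s with
  | EAS => minus1 eps d < x < d
  | LAS_IA => d - 1 < x < plus1 eps (d - 1)
  | LAS_DA => d < x < plus1 eps d
  | LA_AF => minus1 eps d < x < d
  | LA_DF => minus2 eps d < x < minus1 eps d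
  end.

Definition scheduled (eps : R) (s : scheduling_rule)
    (A D : nat -> nat) (A' D' : nat -> R) : Prop :=
  forall k, (1 <= k)%nat ->
    arrival_window eps s (INR (A k)) (A' k) /\
    departure_window eps s (INR (D k)) (D' k).

Inductive epoch : Set :=
  | random_observer | outside_observer
  | pre_arrival | post_arrival | pre_departure | post_departure.

Definition obs_time (eps : R) (s : scheduling_rule) (e : epoch) (tau : nat) : R :=
  let t := INR tau in
  match e with
  | random_observer => t
  | outside_observer => t - 1 / 2
  | pre_arrival =>
      match s with
      | EAS => t
      | LAS_IA | LAS_DA => minus1 eps t
      | LA_AF => minus2 eps t
      | LA_DF => minus1 eps t
      end
  | post_arrival =>
      match s with
      | EAS => plus1 eps t
      | LAS_IA | LAS_DA => t
      | LA_AF => minus1 eps t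
      | LA_DF => t
      end
  | pre_departure =>
      match s with
      | EAS => minus1 eps t
      | LAS_IA | LAS_DA => t
      | LA_AF => minus1 eps t
      | LA_DF => minus2 eps t
      end
  | post_departure =>
      match s with
      | EAS => t
      | LAS_IA | LAS_DA => plus1 eps t
      | LA_AF => t
      | LA_DF => minus1 eps t
      end
  end.

(* The indicator of a < t <= d. *)
Definition present (a d t : R) : R :=
  if Rlt_dec a t then if Rle_dec t d then 1 else 0 else 0.

(* For a scheduled queue both series below have finitely many nonzero terms
   (the first because A_k -> oo), so [Series] is the true sum. *)
Definition L_obs (A' D' u : nat -> R) (tau : nat) : R :=
  Series (fun i => present (A' (S i)) (D' (S i)) (u tau)).

Definition W_obs (A' D' u : nat -> R) (k : nat) : R :=
  Series (fun tau => present (A' k) (D' k) (u tau)).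

Definition coherent (A D : nat -> nat) (A' D' u : nat -> R) : Prop :=
  forall k, (1 <= k)%nat -> W_obs A' D' u k = wait A D k.

Definition sub_coherent (A D : nat -> nat) (A' D' u : nat -> R) : Prop :=
  exists k, (1 <= k)%nat /\ W_obs A' D' u k < wait A D k.

Definition super_coherent (A D : nat -> nat) (A' D' u : nat -> R) : Prop :=
  exists k, (1 <= k)%nat /\ W_obs A' D' u k > wait A D k.

(* Main.v *)
Require Import Defs.
From Stdlib Require Import Reals Ensembles Finite_sets.
From Stdlib Require Import Lra Lia List Arith.
From Coquelicot Require Import Coquelicot.
Open Scope R_scope.

(** The theorem is the sample-path form of Little's law.  Two observations carry
    the proof.

    First, because arrivals and departures are integers and the scheduled
    instants lie within a quarter of a unit of an integer, customer [k] is seen at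
    epoch [t] exactly when [A k + a <= t] and [t + b <= D k], for integers [a] and
    [b] that depend only on the scheduling rule and the epoch
    ([observed_on_integer_interval]).  Hence [W_obs k = wait k + 1 - a - b]: observed
    and actual waiting times differ by the same constant, which is -1, 0 or 1, for
    all customers.  One customer therefore decides whether the system is coherent,
    sub-coherent or super-coherent, and the mean actual wait exists and is off by
    that constant.

    Second, Little's law holds for customers that occupy integer intervals
    ([little_law]).  Let [T n] be the total occupation of the first [n] customers and
    [N t] the number of arrivals up to [t].  Exchanging the order of summation, the
    area under the number in system up to [t] is at most [T (N t)].  Conversely,
    convergence of the averages [T n / n] forces the longest of the first [n]
    occupations to be o(n), so the longest occupation [M] among the arrivals up to
    [t] is o(t); nobody who arrived by [t - M] is seen after [t], and so the area is
    at least [T (N (t - M))].  Both bounds, divided by [t], tend to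
    [lambda * Wo]. *)

(** * Finite sums *)

Lemma sum_from_1_S (f : nat -> R) (n : nat) :
  sum_n_m f 1 (S n) = sum_n_m f 1 n + f (S n).
Proof. rewrite sum_n_Sm; [reflexivity | lia]. Qed.

Lemma sum_from_1_0 (f : nat -> R) : sum_n_m f 1 0 = 0.
Proof. rewrite sum_n_m_zero; [reflexivity | lia]. Qed.

Lemma sum_from_1_le (f g : nat -> R) (n : nat) :
  (forall k, (1 <= k <= n)%nat -> f k <= g k) ->
  sum_n_m f 1 n <= sum_n_m g 1 n.
Proof.
  induction n as [|n IH]; intros H.
  - rewrite !sum_from_1_0; lra.
  - rewrite !sum_from_1_S.
    apply Rplus_le_compat; [apply IH; intros k Hk |]; apply H; lia.
Qed.

Lemma sum_from_1_eq (f g : nat -> R) (n : nat) :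
  (forall k, (1 <= k <= n)%nat -> f k = g k) ->
  sum_n_m f 1 n = sum_n_m g 1 n.
Proof.
  intros H; apply Rle_antisym; apply sum_from_1_le; intros k Hk;
    rewrite (H k Hk); apply Rle_refl.
Qed.

Lemma sum_from_1_mono (f : nat -> R) (m n : nat) :
  (forall k, (1 <= k <= n)%nat -> 0 <= f k) -> (m <= n)%nat ->
  sum_n_m f 1 m <= sum_n_m f 1 n.
Proof.
  intros Hpos Hmn; induction Hmn as [|n Hmn IH]; [lra|].
  rewrite sum_from_1_S.
  assert (0 <= f (S n)) by (apply Hpos; lia).
  assert (sum_n_m f 1 m <= sum_n_m f 1 n) by (apply IH; intros; apply Hpos; lia).
  lra.
Qed.

Lemma sum_from_1_truncate (f : nat -> R) (m n : nat) :
  (forall k, (m < k)%nat -> f k = 0) -> (m <= n)%nat ->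
  sum_n_m f 1 n = sum_n_m f 1 m.
Proof.
  intros H0 Hmn; induction Hmn as [|n Hmn IH]; [reflexivity|].
  rewrite sum_from_1_S, IH, H0; [lra | lia].
Qed.

Lemma sum_exchange (f : nat -> nat -> R) (n t : nat) :
  sum_n_m (fun j => sum_n_m (fun k => f k j) 1 n) 0 t =
  sum_n_m (fun k => sum_n_m (f k) 0 t) 1 n.
Proof.
  induction n as [|n IH].
  - rewrite sum_from_1_0, (sum_n_m_ext _ (fun _ => 0)).
    + rewrite sum_n_m_const; lra.
    + intros j; apply sum_from_1_0.
  - rewrite sum_from_1_S, <- IH.
    rewrite (sum_n_m_ext _
      (fun j => plus (sum_n_m (fun k => f k j) 1 n) (f (S n) j))).
    + exact (sum_n_m_plus (G := R_AbelianMonoid) _ _ 0 t).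
    + intros j; apply sum_from_1_S.
Qed.

Lemma Series_eventually_const (f : nat -> R) (n : nat) (x : R) :
  (forall m, (n <= m)%nat -> sum_n f m = x) -> Series f = x.
Proof.
  intros H; apply is_series_unique.
  change (is_lim_seq (sum_n f) x).
  apply (is_lim_seq_ext_loc (fun _ => x)).
  - exists n; intros m Hm; symmetry; now apply H.
  - apply is_lim_seq_const.
Qed.

Lemma Series_shift_finite (f : nat -> R) (n : nat) :
  (forall k, (n < k)%nat -> f k = 0) ->
  Series (fun i => f (S i)) = sum_n_m f 1 n.
Proof.
  intros H0; apply (Series_eventually_const _ n); intros m Hm.
  unfold sum_n; rewrite (sum_n_m_S f).
  apply sum_from_1_truncate; [exact H0 | lia].
Qed.

(** * Averages *)

Lemma is_lim_seq_inv_INR : is_lim_seq (fun n => / INR n) 0.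
Proof.
  replace (Finite 0) with (Rbar_inv p_infty) by reflexivity.
  apply is_lim_seq_inv; [apply is_lim_seq_INR | discriminate].
Qed.

Lemma eventually_inv_cancel (f : nat -> R) :
  eventually (fun n => INR n * (/ INR n * f n) = f n).
Proof.
  exists 1%nat; intros n Hn; field.
  apply not_0_INR; lia.
Qed.

(** A single term is the difference of two consecutive partial sums, whose
    averages have the same limit. *)
Lemma average_cv_term_negligible (x : nat -> R) (l : R) :
  is_lim_seq (fun n => / INR n * sum_n_m x 1 n) l ->
  is_lim_seq (fun n => / INR n * x n) 0.
Proof.
  intros H.
  apply is_lim_seq_incr_1.
  set (a := fun n => / INR n * sum_n_m x 1 n) in *.
  apply (is_lim_seq_ext_loc
    (fun n => a (S n) - (1 - / INR (S n)) * a n)).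
  - exists 1%nat; intros n Hn; unfold a.
    rewrite sum_from_1_S, S_INR.
    assert (0 < INR n) by (apply lt_0_INR; lia).
    field; lra.
  - replace (Finite 0) with (Finite (l - (1 - 0) * l)) by (f_equal; ring).
    apply is_lim_seq_minus'.
    + apply -> (is_lim_seq_incr_1 a); exact H.
    + apply is_lim_seq_mult'; [|exact H].
      apply is_lim_seq_minus'; [apply is_lim_seq_const|].
      apply -> (is_lim_seq_incr_1 (fun n => / INR n)); apply is_lim_seq_inv_INR.
Qed.

Fixpoint running_max (x : nat -> nat) (n : nat) : nat :=
  match n with O => O | S m => Nat.max (running_max x m) (x (S m)) end.

Lemma running_max_ge (x : nat -> nat) (n k : nat) :
  (1 <= k <= n)%nat -> (x k <= running_max x n)%nat.
Proof.
  induction n as [|n IH]; intros Hk; [lia|]; simpl.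
  destruct (Nat.eq_dec k (S n)) as [->|Hne]; [lia|].
  specialize (IH ltac:(lia)); lia.
Qed.

(** Beyond some [K] the terms are below [d * n]; the finitely many earlier ones
    contribute a constant to the maximum, which is o(n) as well. *)
Lemma running_max_negligible (x : nat -> nat) :
  is_lim_seq (fun n => / INR n * INR (x n)) 0 ->
  is_lim_seq (fun n => / INR n * INR (running_max x n)) 0.
Proof.
  intros H; apply is_lim_seq_spec; intros d.
  apply is_lim_seq_spec in H.
  assert (Hd2 : 0 < d / 2) by (destruct d; simpl; lra).
  destruct (H (mkposreal _ Hd2)) as [K HK]; simpl in HK.
  assert (Hbound : forall n,
    INR (running_max x n) <= INR (running_max x K) + d / 2 * INR n).
  { induction n as [|n IH].
    - simpl; pose proof (pos_INR (running_max x K)); lra.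
    - simpl running_max; rewrite S_INR.
      destruct (Nat.max_spec (running_max x n) (x (S n))) as [[_ ->]|[_ ->]];
        [|lra].
      destruct (le_lt_dec (S n) K) as [HnK|HnK].
      + assert (INR (x (S n)) <= INR (running_max x K))
          by (apply le_INR, running_max_ge; lia).
        pose proof (pos_INR n). nra.
      + specialize (HK (S n) ltac:(lia)).
        assert (Hp : 0 < INR (S n)) by (apply lt_0_INR; lia).
        rewrite Rminus_0_r in HK; apply Rabs_def2 in HK as [HK _].
        apply (Rmult_lt_compat_l _ _ _ Hp) in HK.
        rewrite <- Rmult_assoc, Rinv_r, Rmult_1_l in HK by lra.
        rewrite S_INR in *; pose proof (pos_INR (running_max x K)); lra. }
  pose proof is_lim_seq_inv_INR as Hinv.
  apply (is_lim_seq_scal_l _ (INR (running_max x K))) in Hinv.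
  simpl in Hinv; rewrite Rmult_0_r in Hinv.
  apply is_lim_seq_spec in Hinv.
  destruct (Hinv (mkposreal _ Hd2)) as [K' HK']; simpl in HK'.
  exists (S K'); intros n Hn.
  specialize (HK' n ltac:(lia)).
  assert (Hp : 0 < / INR n) by (apply Rinv_0_lt_compat, lt_0_INR; lia).
  rewrite Rminus_0_r in HK' |- *.
  apply Rabs_def2 in HK' as [HK' _].
  rewrite Rabs_pos_eq by (apply Rmult_le_pos; [lra | apply pos_INR]).
  specialize (Hbound n).
  apply (Rmult_le_compat_l (/ INR n)) in Hbound; [|lra].
  assert (/ INR n * INR n = 1) by (apply Rinv_l; apply not_0_INR; lia).
  nra.
Qed.

(** * Little's law for integer occupation intervals *)

(** The indicator of the integer interval [b <= j < f]. *)
Definition occupied (b f j : nat) : R :=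
  if (Nat.leb b j && Nat.ltb j f)%bool then 1 else 0.

(** Written with [min], the count is meaningful for partly elapsed intervals and
    becomes [f - b] once [t] is past the interval. *)
Lemma sum_occupied (b f t : nat) : (b <= f)%nat ->
  sum_n_m (occupied b f) 0 t = INR (Nat.min f (S t) - Nat.min b (S t)).
Proof.
  intros Hbf; induction t as [|t IH].
  - rewrite sum_n_n; unfold occupied.
    destruct (Nat.leb_spec b 0), (Nat.ltb_spec 0 f); cbn [andb].
    + replace (_ - _)%nat with 1%nat by lia; reflexivity.
    + replace (_ - _)%nat with 0%nat by lia; reflexivity.
    + replace (_ - _)%nat with 0%nat by lia; reflexivity.
    + replace (_ - _)%nat with 0%nat by lia; reflexivity.
  - rewrite sum_n_Sm by lia; rewrite IH; unfold occupied, plus; simpl.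
    destruct (Nat.leb_spec b (S t)), (Nat.ltb_spec (S t) f); cbn [andb].
    + replace (Nat.min f (S (S t)) - Nat.min b (S (S t)))%nat
        with (S (Nat.min f (S t) - Nat.min b (S t))) by lia.
      rewrite S_INR; reflexivity.
    + rewrite Rplus_0_r; f_equal; lia.
    + rewrite Rplus_0_r; f_equal; lia.
    + rewrite Rplus_0_r; f_equal; lia.
Qed.

(** The average of [x] over the first [N t] customers, rescaled from customers to
    time by the arrival rate. *)
Lemma average_along_counts (x : nat -> R) (N : nat -> nat) (l r : R) :
  filterlim N eventually eventually ->
  is_lim_seq (fun t => / INR t * INR (N t)) r ->
  is_lim_seq (fun n => / INR n * x n) l ->
  is_lim_seq (fun t => / INR t * x (N t)) (r * l).
Proof.
  intros HN Hr Hl.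
  apply (is_lim_seq_subseq _ _ N HN) in Hl.
  apply (is_lim_seq_ext_loc
    (fun t => / INR t * INR (N t) * (/ INR (N t) * x (N t)))).
  - destruct (HN _ (eventually_inv_cancel x)) as [K HK].
    exists K; intros t Ht; rewrite Rmult_assoc, (HK t Ht); reflexivity.
  - now apply is_lim_seq_mult'.
Qed.

Section LittleLaw.

Variables A N b f : nat -> nat.
Variables lambda w : R.
Hypothesis count_spec : forall k t, (1 <= k)%nat -> (A k <= t <-> k <= N t)%nat.
Hypothesis begin_near_arrival : forall k, (1 <= k)%nat -> (A k <= b k <= A k + 1)%nat.
Hypothesis begin_le_end : forall k, (1 <= k)%nat -> (b k <= f k)%nat.
Hypothesis rate : is_lim_seq (fun t => / INR t * INR (N t)) lambda.

Let len (k : nat) : nat := (f k - b k)%nat.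
Let total (n : nat) : R := sum_n_m (fun k => INR (len k)) 1 n.

Hypothesis mean_len : is_lim_seq (fun n => / INR n * total n) w.

Lemma counts_diverge : filterlim N eventually eventually.
Proof.
  intros P [K HK]; exists (A (S K)); intros t Ht; apply HK.
  apply count_spec in Ht; lia.
Qed.

Lemma counts_mono (s t : nat) : (s <= t)%nat -> (N s <= N t)%nat.
Proof.
  intros Hst; destruct (Nat.eq_dec (N s) 0) as [E|E]; [lia|].
  apply count_spec; [lia|].
  assert (A (N s) <= s)%nat by (apply count_spec; lia); lia.
Qed.

Definition area (t : nat) : R :=
  sum_n_m (fun j => sum_n_m (fun k => occupied (b k) (f k) j) 1 (N t)) 0 t.

Lemma area_by_customer (t : nat) :
  area t =
  sum_n_m (fun k => INR (Nat.min (f k) (S t) - Nat.min (b k) (S t))) 1 (N t).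
Proof.
  unfold area.
  rewrite (sum_exchange (fun k j => occupied (b k) (f k) j)).
  apply sum_from_1_eq; intros k Hk.
  apply sum_occupied, begin_le_end; lia.
Qed.

Lemma area_le_total (t : nat) : area t <= total (N t).
Proof.
  rewrite area_by_customer; apply sum_from_1_le; intros k Hk.
  apply le_INR; unfold len; lia.
Qed.

(** The longest occupation among the customers that have arrived by [t]. *)
Let longest (t : nat) : nat := running_max len (N t).

(** Customers that arrived by [t - longest t] are not seen after epoch [t], so
    their whole occupation is counted in the area. *)
Lemma total_le_area (t : nat) :
  (longest t <= t)%nat -> total (N (t - longest t)) <= area t.
Proof.
  intros Hlong; rewrite area_by_customer.
  set (s := (t - longest t)%nat).
  assert (Hst : (N s <= N t)%nat) by (apply counts_mono; unfold s; lia).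
  eapply Rle_trans; [|apply sum_from_1_mono; [intros; apply pos_INR | exact Hst]].
  apply sum_from_1_le; intros k Hk.
  assert (HA : (A k <= s)%nat) by (apply count_spec; lia).
  assert (Hlen : (len k <= longest t)%nat) by (apply running_max_ge; lia).
  pose proof (begin_near_arrival k ltac:(lia)).
  pose proof (begin_le_end k ltac:(lia)).
  apply le_INR; unfold len, s in *; lia.
Qed.

Lemma longest_negligible : is_lim_seq (fun t => / INR t * INR (longest t)) 0.
Proof.
  replace 0 with (lambda * 0) by ring.
  apply (average_along_counts (fun n => INR (running_max len n)));
    [apply counts_diverge | exact rate |].
  apply running_max_negligible, (average_cv_term_negligible _ w), mean_len.
Qed.

Lemma longest_le_half : eventually (fun t => (2 * longest t <= t)%nat).
Proof.
  pose proof longest_negligible as H; apply is_lim_seq_spec in H.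
  destruct (H (mkposreal (1 / 2) ltac:(lra))) as [K HK]; simpl in HK.
  exists (S K); intros t Ht; specialize (HK t ltac:(lia)).
  assert (Hp : 0 < INR t) by (apply lt_0_INR; lia).
  rewrite Rminus_0_r in HK; apply Rabs_def2 in HK as [HK _].
  apply (Rmult_lt_compat_l _ _ _ Hp) in HK.
  rewrite <- Rmult_assoc, Rinv_r, Rmult_1_l in HK by lra.
  apply INR_le; rewrite mult_INR; simpl; lra.
Qed.

Lemma little_law : is_lim_seq (fun t => / INR t * area t) (lambda * w).
Proof.
  assert (Htotal : is_lim_seq (fun t => / INR t * total (N t)) (lambda * w)).
  { apply average_along_counts;
      [apply counts_diverge | exact rate | exact mean_len]. }
  assert (Hearly : is_lim_seq (fun t => / INR t * INR (t - longest t)) 1).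
  { apply (is_lim_seq_ext_loc (fun t => 1 - / INR t * INR (longest t))).
    - destruct longest_le_half as [K HK]; exists (S K); intros t Ht.
      specialize (HK t ltac:(lia)); rewrite minus_INR by lia.
      field; apply not_0_INR; lia.
    - replace (Finite 1) with (Finite (1 - 0)) by (f_equal; ring).
      apply is_lim_seq_minus'; [apply is_lim_seq_const | apply longest_negligible]. }
  assert (Hdiv : filterlim (fun t => (t - longest t)%nat) eventually eventually).
  { intros P [K HK]; destruct longest_le_half as [K' HK'].
    exists (2 * K + K')%nat; intros t Ht; apply HK.
    specialize (HK' t ltac:(lia)); lia. }
  apply (is_lim_seq_le_le_loc
    (fun t => / INR t * total (N (t - longest t))) _
    (fun t => / INR t * total (N t))).
  - destruct longest_le_half as [K HK]; exists (S K); intros t Ht.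
    specialize (HK t ltac:(lia)).
    assert (0 <= / INR t) by (left; apply Rinv_0_lt_compat, lt_0_INR; lia).
    split; apply Rmult_le_compat_l; trivial;
      [apply total_le_area; lia | apply area_le_total].
  - replace (lambda * w) with (1 * (lambda * w)) by ring.
    now apply (average_along_counts (fun s => total (N s))).
  - exact Htotal.
Qed.

End LittleLaw.

(** * Counting arrivals *)

Lemma cardinal_enumeration (X : Ensemble nat) (n : nat) :
  cardinal nat X n ->
  exists l, NoDup l /\ length l = n /\ forall x, List.In x l <-> X x.
Proof.
  induction 1 as [|X n HX [l (Hnd & Hlen & Hl)] x Hx].
  - exists nil; repeat split; [constructor | intros [] | intros []].
  - exists (x :: l); repeat split.
    + constructor; [rewrite Hl; exact Hx | exact Hnd].
    + simpl; congruence.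
    + intros [->|Hy]; [right; constructor | left; now apply Hl].
    + intros [y Hy|y Hy]; [right; now apply Hl | left; now inversion Hy].
Qed.

(** Arrival times being ordered, the customers that have arrived by [t] are
    exactly the first [N t] ones. *)
Lemma arrived_by_initial_segment (A D N : nat -> nat) :
  discrete_time_queue A D ->
  (forall t, cardinal nat (arrived_by A t) (N t)) ->
  forall k t, (1 <= k)%nat -> (A k <= t <-> k <= N t)%nat.
Proof.
  intros [Hord Hdiv _] HN k0 t Hk0.
  assert (Hcut : forall n, exists m,
    (m <= n)%nat /\ forall k, (1 <= k <= n)%nat -> (A k <= t <-> k <= m)%nat).
  { assert (Hmono : forall i j, (1 <= i)%nat -> (i <= j)%nat -> (A i <= A j)%nat).
    { intros i j Hi Hij; induction Hij as [|j Hij IH]; [lia|].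
      specialize (Hord j ltac:(lia)); lia. }
    induction n as [|n [m [Hm IH]]]; [exists 0%nat; split; intros; lia|].
    destruct (le_lt_dec (A (S n)) t) as [Ht|Ht].
    - exists (S n); split; [lia|]; intros k Hk.
      specialize (Hmono k (S n) ltac:(lia) ltac:(lia)); lia.
    - exists m; split; [lia|]; intros k Hk.
      destruct (Nat.eq_dec k (S n)) as [->|Hne]; [lia|].
      apply IH; lia. }
  apply is_lim_seq_spec in Hdiv; destruct (Hdiv (INR t)) as [K HK].
  destruct (Hcut K) as [m [Hm Hcutm]].
  assert (Hall : forall k, (1 <= k)%nat -> (A k <= t <-> k <= m)%nat).
  { intros k Hk; destruct (le_lt_dec k K) as [Hle|Hlt]; [apply Hcutm; lia|].
    specialize (HK k ltac:(lia)); apply INR_lt in HK; lia. }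
  destruct (cardinal_enumeration _ _ (HN t)) as [l (Hnd & <- & Hl)].
  assert (Heq : forall k, List.In k l <-> List.In k (seq 1 m)).
  { intros k; rewrite Hl, in_seq; unfold arrived_by; split.
    - intros [Hk Ht]; apply Hall in Ht; lia.
    - intros Hk; split; [lia|]; apply Hall; lia. }
  replace (length l) with m; [now apply Hall|].
  rewrite <- (length_seq m 1); apply Nat.le_antisymm; apply NoDup_incl_length;
    try assumption; try apply seq_NoDup; intros k; apply Heq.
Qed.

(** * What the observer sees *)

Lemma INR_lt_succ (m n : nat) : (m < n)%nat -> INR m + 1 <= INR n.
Proof. intros H; rewrite <- S_INR; apply le_INR; lia. Qed.

(** Every instant involved lies in an open window of width [eps], with end points
    in integer + {-2 eps, -eps, 0, eps}, and [u t] is such an end point or a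
    half-integer; so both comparisons with [u t] are decided by comparing
    integers. *)
Lemma observed_on_integer_interval (eps : R) (s : scheduling_rule) (e : epoch) :
  0 < eps < 1 / 8 ->
  exists a b : nat, (a <= 1 /\ a + b <= 2)%nat /\
    forall (p q : nat) (x y : R),
      arrival_window eps s (INR p) x -> departure_window eps s (INR q) y ->
      forall t, (x < obs_time eps s e t <-> (p + a <= t)%nat) /\
                (obs_time eps s e t <= y <-> (t + b <= q)%nat).
Proof.
  intros Heps.
  (* On each side, an integer inequality and its negation both translate into
     linear inequalities between reals; the pair (a, b) is found by trial. *)
  Ltac decide_shift a b :=
    exists a, b; split; [lia|];
    intros p q x y Hx Hy t;
    unfold obs_time, arrival_window, departure_window,
      minus1, minus2, plus1 in *;
    split; split; intros H;
    [ apply Nat.nlt_ge; intros H'; apply INR_lt_succ in H'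
    | apply le_INR in H
    | apply Nat.nlt_ge; intros H'; apply INR_lt_succ in H'
    | apply le_INR in H ];
    rewrite ?plus_INR in *; simpl INR in *; lra.
  destruct s, e;
    first [ solve [decide_shift 0%nat 0%nat]
          | solve [decide_shift 0%nat 1%nat]
          | solve [decide_shift 1%nat 0%nat]
          | solve [decide_shift 1%nat 1%nat]
          | solve [decide_shift 0%nat 2%nat] ].
Qed.

(** The right end is the first epoch at which the customer is no longer seen; as
    [D k >= 1] and [b <= 2], adding 1 first keeps the natural subtraction exact. *)
Lemma present_occupied (eps : R) (s : scheduling_rule) (e : epoch)
    (A D : nat -> nat) (A' D' : nat -> R) :
  0 < eps < 1 / 8 -> discrete_time_queue A D -> scheduled eps s A D A' D' ->
  exists a b : nat, (a <= 1 /\ a + b <= 2)%nat /\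
    forall k, (1 <= k)%nat -> forall t,
      present (A' k) (D' k) (obs_time eps s e t) =
      occupied (A k + a) (D k + 1 - b) t.
Proof.
  intros Heps [_ _ Hserv] Hs.
  destruct (observed_on_integer_interval eps s e Heps) as [a [b [Hab Hobs]]].
  exists a, b; split; [exact Hab|]; intros k Hk t.
  destruct (Hs k Hk) as [HA HD].
  destruct (Hobs _ _ _ _ HA HD t) as [Hstart Hend].
  specialize (Hserv k Hk).
  unfold present, occupied.
  destruct (Rlt_dec (A' k) _) as [H1|H1].
  - apply Hstart in H1; rewrite (proj2 (Nat.leb_le _ _) H1); cbn [andb].
    destruct (Rle_dec _ (D' k)) as [H2|H2].
    + apply Hend in H2; rewrite (proj2 (Nat.ltb_lt _ _)); [reflexivity | lia].
    + rewrite Hend in H2; rewrite (proj2 (Nat.ltb_ge _ _)); [reflexivity | lia].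
  - rewrite Hstart in H1; rewrite (proj2 (Nat.leb_gt _ _)); [reflexivity | lia].
Qed.

Lemma Series_occupied (b f : nat) :
  (b <= f)%nat -> Series (occupied b f) = INR (f - b).
Proof.
  intros Hbf; apply (Series_eventually_const _ f); intros m Hm.
  unfold sum_n; rewrite sum_occupied by exact Hbf; f_equal; lia.
Qed.

(** * Little's law for observed and actual waiting times *)

Theorem theorem4p2
  (eps : R) (Heps : 0 < eps < 1 / 8)
  (A D : nat -> nat) (HAD : discrete_time_queue A D)
  (s : scheduling_rule) (A' D' : nat -> R) (Hs : scheduled eps s A D A' D')
  (e : epoch) (u : nat -> R) (Hu : u = obs_time eps s e)
  (N : nat -> nat) (HN : forall tau, cardinal nat (arrived_by A tau) (N tau))
  (lambda : R) (Hlambda : 0 <= lambda)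
  (Hrate : is_lim_seq (fun tau => / INR tau * INR (N tau)) lambda)
  (Wo : R) (HWo : 0 <= Wo)
  (Hwait : is_lim_seq (fun n => / INR n * sum_n_m (W_obs A' D' u) 1 n) Wo) :
  exists Lo : R,
    is_lim_seq (fun tau => / INR tau * sum_n_m (L_obs A' D' u) 0 tau) Lo /\
    Lo = lambda * Wo /\
    exists W : R,
      is_lim_seq (fun n => / INR n * sum_n_m (wait A D) 1 n) W /\
      (coherent A D A' D' u -> Lo = lambda * W) /\
      (sub_coherent A D A' D' u -> Lo = lambda * (W - 1)) /\
      (super_coherent A D A' D' u -> Lo = lambda * (W + 1)).
Proof.
  subst u; set (u := obs_time eps s e).
  destruct (present_occupied eps s e A D A' D' Heps HAD Hs) as [a [b [Hab Hocc]]].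
  fold u in Hocc.
  pose proof (service_at_least_one _ _ HAD) as Hserv.
  pose proof (arrived_by_initial_segment A D N HAD HN) as Hcount.
  set (first := fun k => (A k + a)%nat).
  set (last := fun k => (D k + 1 - b)%nat).
  assert (Hfl : forall k, (1 <= k)%nat -> (first k <= last k)%nat).
  { intros k Hk; specialize (Hserv k Hk); unfold first, last; lia. }
  assert (HW : forall k, (1 <= k)%nat ->
    W_obs A' D' u k = INR (last k - first k)).
  { intros k Hk; unfold W_obs.
    rewrite (Series_ext _ _ (Hocc k Hk)).
    apply Series_occupied, Hfl, Hk. }
  set (c := INR a + INR b - 1).
  assert (Hwait_shift : forall k, (1 <= k)%nat ->
    wait A D k = W_obs A' D' u k + c).
  { intros k Hk; rewrite HW by exact Hk; specialize (Hserv k Hk).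
    unfold wait, first, last, c.
    rewrite !minus_INR, !plus_INR by lia; simpl; lra. }
  assert (Hlen : is_lim_seq
    (fun n => / INR n * sum_n_m (fun k => INR (last k - first k)) 1 n) Wo).
  { eapply is_lim_seq_ext; [|exact Hwait]; intros n; cbv beta; f_equal.
    apply sum_from_1_eq; intros k Hk; apply HW; lia. }
  exists (lambda * Wo); split; [|split; [reflexivity|]].
  - assert (Hnear : forall k, (1 <= k)%nat -> (A k <= first k <= A k + 1)%nat)
      by (intros k _; unfold first; lia).
    pose proof (little_law A N first last lambda Wo Hcount Hnear Hfl Hrate Hlen)
      as Hlittle.
    eapply is_lim_seq_ext; [|exact Hlittle].
    intros t; cbv beta; f_equal; unfold area.
    apply sum_n_m_ext_loc; intros j [_ Hj].
    unfold L_obs; symmetry.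
    rewrite (Series_shift_finite
      (fun k => present (A' k) (D' k) (u j)) (N t)).
    + apply sum_from_1_eq; intros k Hk; apply Hocc; lia.
    + (* A customer beyond the first [N t] arrives after [t >= j]. *)
      intros k Hk; rewrite Hocc by lia; unfold occupied.
      assert (~ (A k <= t)%nat) by (rewrite Hcount; lia).
      rewrite (proj2 (Nat.leb_gt _ _)); [reflexivity | lia].
  - exists (Wo + c); split.
    + apply (is_lim_seq_ext_loc
        (fun n => / INR n * sum_n_m (W_obs A' D' u) 1 n + c)).
      * exists 1%nat; intros n Hn.
        rewrite (sum_from_1_eq (wait A D)
          (fun k => plus (W_obs A' D' u k) c)) by
          (intros k Hk; apply Hwait_shift; lia).
        rewrite sum_n_m_plus, sum_n_m_const.
        replace (S n - 1)%nat with n by lia.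
        change plus with Rplus; field; apply not_0_INR; lia.
      * apply is_lim_seq_plus'; [exact Hwait | apply is_lim_seq_const].
    + (* Since [a + b <= 2], the sign of the common shift determines it. *)
      assert (Hc : c = -1 \/ c = 0 \/ c = 1).
      { unfold c; rewrite <- plus_INR.
        destruct (a + b)%nat as [|[|[|n]]] eqn:E; [simpl; lra.. | lia]. }
      repeat split.
      * intros Hcoh; specialize (Hcoh 1%nat (le_n 1)).
        rewrite Hwait_shift in Hcoh by lia.
        replace c with 0 by lra; ring.
      * intros [k [Hk Hlt]]; rewrite Hwait_shift in Hlt by exact Hk.
        replace c with 1 by lra; ring.
      * intros [k [Hk Hgt]]; rewrite Hwait_shift in Hgt by exact Hk.
        replace c with (-1) by lra; ring.
Qed.
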